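(* Let $\Omega=\Omega(A)$ be a standard differential graded algebra and let $\perp$ be a degree $-2$ bilinear map on $\Omega$ such that $\omega\perp a=a\perp\omega=0$ for all $a\in A$, $\omega\in\Omega$, and $$(-1)^{|\eta|}(\omega\eta)\perp\zeta+(\omega\perp\eta)\zeta=\omega\perp(\eta\zeta)+(-1)^{|\omega|+|\eta|}\omega(\eta\perp\zeta),\qquad\forall\omega,\eta,\zeta\in\Omega.$$ Let $\delta$ be a regular degree $-1$ linear map on $\Omega$ with $$\delta(a\omega)-a\delta\omega=\mathrm da\perp\omega,\qquad\forall a\in A,\ \omega\in\Omega.$$ Then there is a regular flat cleft extension $(\Delta,[\![\ ,\ ]\!])$ of $\Omega$ given by $\Delta=\mathrm d\delta+\delta\mathrm d$ and $$[\![\omega,\eta]\!]=L_\delta(\omega,\eta)+\omega\perp\mathrm d\eta-(-1)^{|\omega|}\mathrm d\omega\perp\eta-(-1)^{|\omega|}\mathrm d(\omega\perp\eta),\qquad\forall\omega,\eta\in\Omega.$$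
   Context: $A$ is a unital algebra over a field $k$ of characteristic $\ne2$. A DGA on $A$ is an associative graded algebra $\Omega=\oplus_{n\ge0}\Omega^n$ with $\Omega^0=A$ and a graded derivation $\mathrm d$ of degree $1$, $\mathrm d^2=0$. It is standard if $\Omega^1$ is spanned by elements $a\,\mathrm db$ and $\Omega$ is generated by degrees $0,1$. $L_\delta(\omega,\eta)=\delta(\omega\eta)-(\delta\omega)\eta-(-1)^{|\omega|}\omega\delta\eta$. A degree $-1$ linear map $\delta$ on $\Omega$ is regular if there are bimodule maps $\mathfrak i:\Omega^1\otimes_A\Omega^n\to\Omega^{n-1}$ and $\grave{\mathfrak i}:\Omega^n\otimes_A\Omega^1\to\Omega^{n-1}$ (the latter written $\omega\grave{\mathfrak i}_\zeta$, acting from the right) with $\delta(a\omega)=a\delta\omega+\mathfrak i_{\mathrm da}\omega$ and $\delta(\omega a)=(\delta\omega)a+\omega\grave{\mathfrak i}_{\mathrm da}$ for all $a\in A$, $\omega\in\Omega$. A (central extension) cocycle on $\Omega$ is a pair of a degree $0$ linear map $\Delta$ and a degree $-1$ bilinear map $[\![\ ,\ ]\!]$ on $\Omega$ with $[\Delta,\mathrm d]=0$ and, for all $\omega,\eta,\zeta\in\Omega$, $[\![\omega\eta,\zeta]\!]+[\![\omega,\eta]\!]\zeta=[\![\omega,\eta\zeta]\!]+(-1)^{|\omega|}\omega[\![\eta,\zeta]\!]$ and $\Delta(\omega\eta)-(\Delta\omega)\eta-\omega\Delta\eta=\mathrm d[\![\omega,\eta]\!]+[\![\mathrm d\omega,\eta]\!]+(-1)^{|\omega|}[\![\omega,\mathrm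 d\eta]\!]$. (Such pairs are the data of central extensions of the DGA $\Omega$ by a graded-central closed 1-form $\theta'$ with $\theta'^2=0$.) It is a cleft extension if $[\![a,\ ]\!]=0$ for all $a\in A$; it is flat if $\Delta=\mathrm d\delta'+\delta'\mathrm d$ for some degree $-1$ linear map $\delta'$; a cleft extension is regular if $\mathfrak j_\omega(a\,\mathrm db)=\frac12[\![\omega a,b]\!]$ is a well-defined map $\mathfrak j:\Omega^i\otimes_A\Omega^1\to\Omega^{i-1}$ for all $i$. *)

(* Defs.v *)
From HB Require Import structures.
From mathcomp Require Import all_boot all_order all_algebra.

Set Implicit Arguments.
Unset Strict Implicit.
Unset Printing Implicit Defensive.

Import GRing.Theory.
Local Open Scope ring_scope.

(* An N-grading of an algebra as an internal direct sum, given by the          *)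
(* projections onto the homogeneous components: [gr_proj n x] is the degree n  *)
(* part of x, and degree n elements are the fixed points of [gr_proj n].       *)
Record grading (k : fieldType) (E : algType k) := Grading {
  gr_proj : nat -> {linear E -> E};
  gr_projK : forall m n x,
    gr_proj m (gr_proj n x) = if m == n then gr_proj n x else 0;
  gr_sum : forall x, exists N, x = \sum_(n < N) gr_proj n x;
  gr_mul : forall m n x y,
    gr_proj (m + n) (gr_proj m x * gr_proj n y) = gr_proj m x * gr_proj n y
}.

(* Degrees are integers so that maps of negative degree can be described;      *)
(* the components of negative degree are zero.                                 *)
Definition homog (k : fieldType) (E : algType k) (G : grading E) (z : int) :
    {pred E} :=
  [pred x | match z with
            | Posz n => gr_proj G n x == x
            | Negz _ => x == 0
            end].

(* A differential graded algebra on A; [dga_inc] identifies A with the degree  *)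
(* 0 component.                                                                *)
Record dga (k : fieldType) (A : algType k) := Dga {
  dga_sort :> algType k;
  dga_gr : grading dga_sort;
  dga_inc : {lrmorphism A -> dga_sort};
  dga_d : {linear dga_sort -> dga_sort};
  dga_inc_inj : injective dga_inc;
  dga_incP : forall x, x \in homog dga_gr 0 <-> exists a, x = dga_inc a;
  dga_d_deg : forall (n : nat) x,
    x \in homog dga_gr n%:Z -> dga_d x \in homog dga_gr n.+1%:Z;
  dga_dd : forall x, dga_d (dga_d x) = 0;
  dga_dM : forall (n : nat) x y, x \in homog dga_gr n%:Z ->
    dga_d (x * y) = dga_d x * y + (-1) ^+ n *: (x * dga_d y)
}.

Section DgaDefs.

Context {k : fieldType} {A : algType k} {Om : dga A}.

Definition deg (z : int) : {pred Om} := homog (dga_gr Om) z.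
Definition inc : A -> Om := dga_inc Om.
Definition d : Om -> Om := dga_d Om.

Inductive generated01 : Om -> Prop :=
| gen_deg0 x : x \in deg 0 -> generated01 x
| gen_deg1 x : x \in deg 1 -> generated01 x
| gen_lin (c : k) x y :
    generated01 x -> generated01 y -> generated01 (c *: x + y)
| gen_mul x y : generated01 x -> generated01 y -> generated01 (x * y).

Definition standard : Prop :=
  (forall w, w \in deg 1 ->
     exists s : seq (A * A), w = \sum_(p <- s) inc p.1 * d (inc p.2))
  /\ (forall w, generated01 w).

Definition map_degree (z : int) (f : Om -> Om) : Prop :=
  forall (n : nat) x, x \in deg n%:Z -> f x \in deg (n%:Z + z).

Definition bimap_degree (z : int) (f : Om -> Om -> Om) : Prop :=
  forall (m n : nat) x y, x \in deg m%:Z -> y \in deg n%:Z ->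
    f x y \in deg (m%:Z + n%:Z + z).

(* f restricts to a k-linear map Om^m (x)_A Om^n -> Om^p, where such a map is  *)
(* an A-balanced k-bilinear map on Om^m x Om^n. The values of f outside        *)
(* Om^m x Om^n are irrelevant.                                                 *)
Definition tensor_map (m n p : int) (f : Om -> Om -> Om) : Prop :=
  [/\ forall x y, x \in deg m -> y \in deg n -> f x y \in deg p,
      forall (c : k) x x' y, x \in deg m -> x' \in deg m -> y \in deg n ->
        f (c *: x + x') y = c *: f x y + f x' y,
      forall (c : k) x y y', x \in deg m -> y \in deg n -> y' \in deg n ->
        f x (c *: y + y') = c *: f x y + f x y'
    & forall a x y, x \in deg m -> y \in deg n ->
        f (x * inc a) y = f x (inc a * y)].

Definition bimodule_tensor_map (m n p : int) (f : Om -> Om -> Om) : Prop :=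
  [/\ tensor_map m n p f,
      forall a x y, x \in deg m -> y \in deg n ->
        f (inc a * x) y = inc a * f x y
    & forall a x y, x \in deg m -> y \in deg n ->
        f x (y * inc a) = f x y * inc a].

(* [il n v x] is i_v x and [ir n x v] is x i`_v, for v in Om^1, x in Om^n. *)
Definition regular_map (delta : Om -> Om) : Prop :=
  exists il ir : nat -> Om -> Om -> Om,
    [/\ forall n : nat, bimodule_tensor_map 1 n%:Z (n%:Z - 1) (il n),
        forall n : nat, bimodule_tensor_map n%:Z 1 (n%:Z - 1) (ir n),
        forall (n : nat) a x, x \in deg n%:Z ->
          delta (inc a * x) = inc a * delta x + il n (d (inc a)) x
      & forall (n : nat) a x, x \in deg n%:Z ->
          delta (x * inc a) = delta x * inc a + ir n x (d (inc a))].

(* L_delta(x, y) for x of degree m. *)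
Definition Lop (delta : Om -> Om) (m : nat) (x y : Om) : Om :=
  delta (x * y) - delta x * y - (-1) ^+ m *: (x * delta y).

Definition cocycle (Delta : {linear Om -> Om})
    (br : {bilinear Om -> Om -> Om}) : Prop :=
  [/\ map_degree 0 Delta,
      bimap_degree (-1) br,
      forall x, Delta (d x) = d (Delta x),
      forall (m : nat) x y z, x \in deg m%:Z ->
        br (x * y) z + br x y * z = br x (y * z) + (-1) ^+ m *: (x * br y z)
    & forall (m : nat) x y, x \in deg m%:Z ->
        Delta (x * y) - Delta x * y - x * Delta y
        = d (br x y) + br (d x) y + (-1) ^+ m *: br x (d y)].

Definition cleft (br : Om -> Om -> Om) : Prop :=
  forall a x, br (inc a) x = 0.

Definition flat (Delta : Om -> Om) : Prop :=
  exists delta' : {linear Om -> Om},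
    map_degree (-1) delta' /\
    forall x, Delta x = d (delta' x) + delta' (d x).

Definition regular_bracket (br : Om -> Om -> Om) : Prop :=
  exists j : nat -> Om -> Om -> Om,
    forall i : nat,
      tensor_map i%:Z 1 (i%:Z - 1) (j i) /\
      forall w a b, w \in deg i%:Z ->
        j i w (inc a * d (inc b)) = 2^-1 *: br (w * inc a) (inc b).

End DgaDefs.

Arguments standard {k A} Om.

(* Main.v *)
(* Both cocycle identities are formal. The Hochschild identity holds for L_delta
   by associativity; for the remaining part of the bracket it follows by adding
   the perp identity at (w, e, dz), (dw, e, z) and (w, de, z), with suitable
   signs, to the exterior derivative of the identity at (w, e, z). That
   remaining part is a coboundary for d, so Delta sees only L_delta. Since
   delta vanishes on A, [[w, b]] = w i_(db) + perp(w, db), and perp is balanced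
   over A, which gives regularity. *)
Require Import Defs.
From HB Require Import structures.
From mathcomp Require Import all_boot all_order all_algebra.
From Stdlib Require Ncring Ncring_tac.
From mathcomp Require Import zify.

Set Implicit Arguments.
Unset Strict Implicit.
Unset Printing Implicit Defensive.

Import GRing.Theory.
Local Open Scope ring_scope.

(** * Noncommutative polynomial identities by reflection *)

Section NoncommutativeRing.

Context (E : nzRingType).

#[local] Instance ncring_ops :
  @Ncring.Ring_ops E 0 1 +%R *%R (fun x y => x - y) -%R eq := {}.

#[local] Instance ncring : Ncring.Ring (Ro := ncring_ops).
Proof.
split.
- exact: RelationClasses.eq_equivalence.
- by move=> x _ <- y _ <-.
- by move=> x _ <- y _ <-.
- by move=> x _ <- y _ <-.
- by move=> x _ <-.
- exact (@add0r E).
- exact (@addrC E).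
- exact (@addrA E).
- exact (@mul1r E).
- exact (@mulr1 E).
- exact (@mulrA E).
- exact (@mulrDl E).
- exact (fun x y z => @mulrDr E z x y).
- by [].
- exact (@addrN E).
Qed.

End NoncommutativeRing.

#[local] Existing Instance ncring_ops.
#[local] Existing Instance ncring.

(** * Signs and homogeneous components *)

Lemma sign_cases (R : pzRingType) n :
  (-1) ^+ n = 1 :> R \/ (-1) ^+ n = -1 :> R.
Proof. by rewrite -signr_odd; case: (odd n); [right | left]. Qed.

Section Grading.

Context (k : fieldType) (E : algType k) (G : grading E).

Lemma homogD z x y :
  x \in homog G z -> y \in homog G z -> x + y \in homog G z.
Proof.
case: z => n; rewrite !inE => /eqP hx /eqP hy; apply/eqP.
  by rewrite linearD /= hx hy.
by rewrite hx hy addr0.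
Qed.

Lemma homogZ z c x : x \in homog G z -> c *: x \in homog G z.
Proof.
case: z => n; rewrite !inE => /eqP hx; apply/eqP.
  by rewrite linearZ /= hx.
by rewrite hx scaler0.
Qed.

Lemma homogB z x y :
  x \in homog G z -> y \in homog G z -> x - y \in homog G z.
Proof. by move=> hx hy; rewrite -scaleN1r; apply/homogD/homogZ. Qed.

Lemma homog0 z : 0 \in homog G z.
Proof. by case: z => n; rewrite inE ?linear0 ?eqxx. Qed.

Lemma homogM z1 z2 x y :
  x \in homog G z1 -> y \in homog G z2 -> x * y \in homog G (z1 + z2).
Proof.
case: z1 => m; last by move=> /eqP-> _; rewrite mul0r homog0.
case: z2 => n; last by move=> _ /eqP->; rewrite mulr0 homog0.
by rewrite !inE -PoszD => /eqP <- /eqP <-; rewrite gr_mul.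
Qed.

Lemma gr_proj_homog n x : gr_proj G n x \in homog G n%:Z.
Proof. by rewrite inE gr_projK eqxx. Qed.

Lemma gr_ind (P : E -> Prop) :
  P 0 -> (forall x y, P x -> P y -> P (x + y)) ->
  (forall (n : nat) x, x \in homog G n%:Z -> P x) -> forall x, P x.
Proof.
move=> P0 PD Ph x; have [N ->] := gr_sum G x.
by apply: big_ind => // n _; apply/Ph/gr_proj_homog.
Qed.

Lemma gr_proj_eq0 x : exists N, forall n, (N <= n)%N -> gr_proj G n x = 0.
Proof.
have [N ->] := gr_sum G x; exists N => n leNn.
rewrite linear_sum big1 // => i _.
by rewrite gr_projK gtn_eqF // (leq_trans (ltn_ord i)).
Qed.

(** Boolean form, from which [xchoose] can extract a bound in [gr_sign]. *)
Lemma gr_sum_bool x : exists N, x == \sum_(n < N) gr_proj G n x.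
Proof. by have [N eqx] := gr_sum G x; exists N; apply/eqP. Qed.

(* [gr_sign x] is (-1)^|x| x on homogeneous x. The bracket is only prescribed
   for homogeneous left arguments; this linear extension of the sign makes it
   bilinear on all of Om. *)
Definition gr_sign x :=
  \sum_(n < xchoose (gr_sum_bool x)) (-1) ^+ n *: gr_proj G n x.

(** The value does not depend on the bound picked by [xchoose]: two sums that run past all nonzero
    components extend by zero terms to the larger bound. *)
Lemma gr_signE N x : (forall n, (N <= n)%N -> gr_proj G n x = 0) ->
  gr_sign x = \sum_(n < N) (-1) ^+ n *: gr_proj G n x.
Proof.
move=> hN; rewrite /gr_sign; move: (xchoose _) (xchooseP (gr_sum_bool x)).
move=> M /eqP eqx.
have hM n : (M <= n)%N -> gr_proj G n x = 0.
  move=> leMn; rewrite eqx linear_sum big1 // => i _.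
  by rewrite gr_projK gtn_eqF // (leq_trans (ltn_ord i)).
pose F n := (-1) ^+ n *: gr_proj G n x.
have widenE K : (K <= maxn M N)%N ->
    (forall n, (K <= n)%N -> gr_proj G n x = 0) ->
    \sum_(n < K) F n = \sum_(n < maxn M N) F n.
  move=> leK hK; rewrite (big_ord_widen _ F leK) big_mkcond /=.
  by apply: eq_bigr => i _; case: ltnP => // /hK; rewrite /F => ->; rewrite scaler0.
by rewrite (widenE M) ?leq_maxl // -(widenE N) ?leq_maxr.
Qed.

Lemma gr_sign_is_linear : linear gr_sign.
Proof.
move=> c x y; have [[M hM] [N hN]] := (gr_proj_eq0 x, gr_proj_eq0 y).
have hM' n : (maxn M N <= n)%N -> gr_proj G n x = 0.
  by rewrite geq_max => /andP[/hM].
have hN' n : (maxn M N <= n)%N -> gr_proj G n y = 0.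
  by rewrite geq_max => /andP[_ /hN].
(* The maximum of the bounds for [x] and [y] also bounds [c *: x + y], so all three sums run over
   one range. *)
rewrite (gr_signE hM') (gr_signE hN') (@gr_signE (maxn M N)); last first.
  by move=> n le_n; rewrite linearP hM' // hN' // scaler0 addr0.
rewrite scaler_sumr -big_split; apply: eq_bigr => i _ /=.
by rewrite linearP scalerDr !scalerA mulrC.
Qed.

HB.instance Definition _ :=
  GRing.isLinear.Build k E E *:%R gr_sign gr_sign_is_linear.

Lemma gr_sign_homog (n : nat) x :
  x \in homog G n%:Z -> gr_sign x = (-1) ^+ n *: x.
Proof.
rewrite inE => /eqP eqx; rewrite (@gr_signE n.+1); last first.
  by move=> m lt_nm; rewrite -eqx gr_projK gtn_eqF.
rewrite big_ord_recr /= eqx big1 ?add0r // => i _.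
by rewrite -eqx gr_projK ltn_eqF ?scaler0.
Qed.

End Grading.

(** * Degrees and the Leibniz rule in a DGA *)

Section Dga.

Context (k : fieldType) (A : algType k) (Om : dga A).

Lemma degM z1 z2 (x y : Om) :
  x \in deg z1 -> y \in deg z2 -> x * y \in deg (z1 + z2).
Proof. exact: homogM. Qed.

Lemma degD z (x y : Om) : x \in deg z -> y \in deg z -> x + y \in deg z.
Proof. exact: homogD. Qed.

Lemma degB z (x y : Om) : x \in deg z -> y \in deg z -> x - y \in deg z.
Proof. exact: homogB. Qed.

Lemma degZ z c (x : Om) : x \in deg z -> c *: x \in deg z.
Proof. exact: homogZ. Qed.

Lemma deg_cast z z' (x : Om) : x \in deg z -> z = z' -> x \in deg z'.
Proof. by move=> hx <-. Qed.

Lemma d_deg z (x : Om) : x \in deg z -> d x \in deg (z + 1).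
Proof.
case: z => n; first by rewrite -PoszD addn1; apply: dga_d_deg.
by move=> /eqP->; rewrite /d linear0; apply: homog0.
Qed.

Lemma inc_homog a : inc a \in @deg k A Om 0.
Proof. by apply/dga_incP; exists a. Qed.

(* When p < r, x is zero, so the truncation-free sign (-1)^(p + r) is harmless. *)
Lemma dM_shift (p r : nat) (x y : Om) : x \in deg (p%:Z - r%:Z) ->
  d (x * y) = d x * y + (-1) ^+ (p + r) *: (x * d y).
Proof.
case: (leqP r p) => [le_rp | lt_pr].
  rewrite subzn // /d => /dga_dM ->; congr (_ + _ *: _).
  (* [p + r] and [p - r] differ by the even number [2 * r], so the signs agree. *)
  by rewrite -{2}(subnK le_rp) -addnA exprD addnn -mul2n exprM sqrrN !expr1n mulr1.
have -> : p%:Z - r%:Z = Negz (r - p).-1 by lia.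
by move=> /eqP->; rewrite /d !(mul0r, linear0, scaler0, addr0).
Qed.

End Dga.

(** * The bracket and its two cocycle identities *)

Section Bracket.

Context (k : fieldType) (A : algType k) (Om : dga A).
Context (perp : {bilinear Om -> Om -> Om}) (delta : {linear Om -> Om}).

(** In the second [perp] term the sign is applied before the differential, so that it is the sign of
    [x] and not that of [d x]. *)
Definition bracket (x y : Om) : Om :=
  delta (x * y) - delta x * y - gr_sign (dga_gr Om) x * delta y
  + perp x (dga_d Om y) - perp (dga_d Om (gr_sign (dga_gr Om) x)) y
  - dga_d Om (perp (gr_sign (dga_gr Om) x) y).

Lemma bracket_is_bilinear :
  bilinear_for (GRing.Scale.Law.clone _ _ *:%R _)
    (GRing.Scale.Law.clone _ _ *:%R _) bracket.
Proof.
split=> [y | x] c u v; rewrite /bracket.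
  rewrite mulrDl -scalerAl !linearP /= !linearDl !linearZl_LR !mulrDl.
  rewrite -!scalerAl (linearP (dga_d Om)) /= !scalerDr !scalerN.
  by Ncring_tac.non_commutative_ring.
rewrite mulrDr -scalerAr !linearP /= !mulrDr -!scalerAr /=.
by rewrite !scalerDr !scalerN; Ncring_tac.non_commutative_ring.
Qed.

HB.instance Definition _ := bilinear_isBilinear.Build k Om Om Om
  (GRing.Scale.Law.clone _ _ *:%R _) (GRing.Scale.Law.clone _ _ *:%R _)
  bracket bracket_is_bilinear.

Lemma bracketDl z : {morph bracket^~ z : x y / x + y}.
Proof. exact: linearDl. Qed.

Lemma bracketDr x : {morph bracket x : y z / y + z}.
Proof. exact: linearDr. Qed.

(** The graded commutator of [d] and [delta], as in Cartan's formula for the Lie derivative. *)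
Definition cartan : Om -> Om :=
  (dga_d Om \o delta) \+ (delta \o dga_d Om).

HB.instance Definition _ := GRing.Linear.on cartan.

Context (perp_deg : bimap_degree (- 2) perp).
Context (perp_cocycle : forall (m n : nat) (w e z : Om),
  w \in deg m%:Z -> e \in deg n%:Z ->
  (-1) ^+ n *: perp (w * e) z + perp w e * z
  = perp w (e * z) + (-1) ^+ (m + n) *: (w * perp e z)).
Context (delta_deg : map_degree (- 1) delta).

Lemma bracketE (m : nat) (x y : Om) : x \in deg m%:Z ->
  bracket x y = delta (x * y) - delta x * y - (-1) ^+ m *: (x * delta y)
    + perp x (d y) - (-1) ^+ m *: perp (d x) y - (-1) ^+ m *: d (perp x y).
Proof.
move=> hx; rewrite /bracket (gr_sign_homog hx) -scalerAl.
by rewrite (linearZ_LR (dga_d Om)) !linearZl_LR /= (linearZ_LR (dga_d Om)).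
Qed.

Lemma bracket_deg : bimap_degree (-1) bracket.
Proof.
move=> m n x y hx hy; rewrite (bracketE _ hx).
have hdx : d x \in deg m.+1%:Z by apply: dga_d_deg.
have hdy : d y \in deg n.+1%:Z by apply: dga_d_deg.
repeat first [apply: degB | apply: degD | apply: degZ].
- by apply: delta_deg; rewrite PoszD; apply: degM.
- by apply: (deg_cast (degM (delta_deg hx) hy)); lia.
- by apply: (deg_cast (degM hx (delta_deg hy))); lia.
- by apply: (deg_cast (perp_deg hx hdy)); lia.
- by apply: (deg_cast (perp_deg hdx hy)); lia.
- by apply: (deg_cast (d_deg (perp_deg hx hy))); lia.
Qed.

Lemma cartan_deg : map_degree 0 cartan.
Proof.
move=> n x hx; apply: (degD (x := d (delta x)) (y := delta (d x))).
  by apply: (deg_cast (d_deg (delta_deg hx))); lia.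
have hdx : d x \in deg n.+1%:Z by apply: dga_d_deg.
by apply: (deg_cast (delta_deg hdx)); lia.
Qed.

(** The cocycle identity oriented as a rewriting rule: it removes products from the second argument
    of [perp]. *)
Lemma perpMr (m n : nat) (x y z : Om) : x \in deg m%:Z -> y \in deg n%:Z ->
  perp x (y * z) = (-1) ^+ n *: perp (x * y) z + perp x y * z
                   - (-1) ^+ (m + n) *: (x * perp y z).
Proof. by move=> hx hy; rewrite (perp_cocycle _ hx hy) addrK. Qed.

Lemma bracket_hochschild_deg (m n : nat) (x y z : Om) :
  x \in deg m%:Z -> y \in deg n%:Z ->
  bracket (x * y) z + bracket x y * z
  = bracket x (y * z) + (-1) ^+ m *: (x * bracket y z).
Proof.
move=> hx hy.
have hxy : x * y \in deg (m + n)%:Z by rewrite PoszD; apply: degM.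
have hdx : d x \in deg m.+1%:Z by apply: dga_d_deg.
have hdy : d y \in deg n.+1%:Z by apply: dga_d_deg.
have hp : perp x y \in deg ((m + n)%:Z - 2%:Z) by rewrite PoszD; apply: perp_deg.
rewrite (bracketE _ hxy) !(bracketE _ hx) (bracketE _ hy).
rewrite /d !(dga_dM _ hx) !(dga_dM _ hy) -!/(d _).
rewrite (linearDr perp x) linearZr_LR.
(* After these rewrites the two sides agree as noncommutative polynomials. *)
rewrite (perpMr _ hx hdy) (perpMr _ hx hy) (perpMr _ hdx hy) (perpMr _ hx hy).
rewrite /d !(linearB, linearD, linearZ) /= -!/(d _).
(* [perp x y] has degree [m + n - 2], possibly negative. Writing the degree of [x] as [m - 0] lets
   the same rule expand the differential of [x * perp y z]. *)
rewrite (dM_shift _ hp) (dM_shift _ (_ : x \in deg (m%:Z - 0%:Z))) ?subr0 //.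
rewrite linearDl linearZl_LR.
rewrite ?addnS ?addSn ?addn0 ?exprS !exprD ?expr1 ?expr0.
(* The ring procedure knows no scalars; once each sign is 1 or -1, scaling becomes identity or
   negation. *)
case: (sign_cases k m) => ->; case: (sign_cases k n) => ->;
rewrite ?(mulN1r, mulr1, mul1r, opprK, scale1r, scaleN1r) !mulrA;
by Ncring_tac.non_commutative_ring.
Qed.

(** The [perp] identity involves the degree of the middle argument, hence the homogeneous case
    first; both sides are additive in [y]. *)
Lemma bracket_hochschild (m : nat) (x y z : Om) : x \in deg m%:Z ->
  bracket (x * y) z + bracket x y * z
  = bracket x (y * z) + (-1) ^+ m *: (x * bracket y z).
Proof.
move=> hx; elim/(gr_ind (G := dga_gr Om)): y.
- by rewrite mul0r mulr0 !linear0l !linear0r mul0r mulr0 scaler0 addr0.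
- move=> y y' IHy IHy'; rewrite mulrDr bracketDr (mulrDl (bracket x y)).
  rewrite (mulrDl y) bracketDr !bracketDl (mulrDr x (bracket y z)) scalerDr.
  by rewrite addrACA IHy IHy' addrACA.
- by move=> n y; apply: bracket_hochschild_deg.
Qed.

(** The [perp] terms cancel in pairs by [d] squared being zero: [d (perp x (d y))],
    [d (perp (d x) y)] and [perp (d x) (d y)] each occur twice with opposite signs. The rest is the
    Leibniz rule. *)
Lemma bracket_cartan (m : nat) (x y : Om) : x \in deg m%:Z ->
  cartan (x * y) - cartan x * y - x * cartan y
  = d (bracket x y) + bracket (d x) y + (-1) ^+ m *: bracket x (d y).
Proof.
move=> hx; have hdx : d x \in deg m.+1%:Z by apply: dga_d_deg.
have hdelta : delta x \in deg (m%:Z - 1%:Z) by apply: delta_deg.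
rewrite !(bracketE _ hx) (bracketE _ hdx) /cartan /=.
rewrite -!/(d _) {2}/d (dga_dM _ hx) -!/(d _).
rewrite /d !(linearB, linearD, linearZ) /= -!/(d _).
rewrite (dM_shift _ hdelta) (dM_shift _ (_ : x \in deg (m%:Z - 0%:Z))) ?subr0 //.
rewrite /d !dga_dd -!/(d _) linear0r linear0l linear0.
rewrite ?addnS ?addSn ?addn0 ?exprS ?expr1 ?expr0.
case: (sign_cases k m) => ->;
rewrite ?(mulN1r, mulr1, mul1r, opprK, scale1r, scaleN1r);
by Ncring_tac.non_commutative_ring.
Qed.

End Bracket.

(** * Assembly of the extension: cleft, flat and regular *)

Theorem theorem3p12 (k : fieldType) (A : algType k) (Om : dga A)
  (perp : {bilinear Om -> Om -> Om}) (delta : {linear Om -> Om})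
  (char_k : 2%N \notin [pchar k])
  (Om_standard : standard Om)
  (perp_deg : bimap_degree (- 2) perp)
  (perp_inc : forall (a : A) (w : Om),
     perp w (inc a) = 0 /\ perp (inc a) w = 0)
  (perp_cocycle : forall (m n : nat) (w e z : Om),
     w \in deg m%:Z -> e \in deg n%:Z ->
     (-1) ^+ n *: perp (w * e) z + perp w e * z
     = perp w (e * z) + (-1) ^+ (m + n) *: (w * perp e z))
  (delta_deg : map_degree (- 1) delta)
  (delta_regular : regular_map delta)
  (delta_perp : forall (a : A) (w : Om),
     delta (inc a * w) - inc a * delta w = perp (d (inc a)) w) :
  exists (Delta : {linear Om -> Om}) (br : {bilinear Om -> Om -> Om}),
    [/\ forall w : Om, Delta w = d (delta w) + delta (d w),
        forall (m : nat) (w e : Om), w \in deg m%:Z ->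
          br w e = Lop delta m w e + perp w (d e)
                   - (-1) ^+ m *: perp (d w) e
                   - (-1) ^+ m *: d (perp w e),
        cocycle Delta br
      & [/\ cleft br, flat Delta & regular_bracket br]].
Proof.
have delta_inc a : delta (inc a) = 0.
  (* [delta] sends degree 0 to degree -1, where membership in [deg] means being zero. *)
  by apply/eqP; exact: (delta_deg 0%N _ (inc_homog Om a)).
exists (cartan delta), (bracket perp delta); split=> //.
- by move=> m w e hw; rewrite /= (bracketE _ _ _ hw).
- split.
  + exact: cartan_deg.
  + exact: bracket_deg.
  + by move=> x; rewrite /= /cartan /d /= linearD /= !dga_dd linear0 addr0 add0r.
  + by move=> m x y z; apply: bracket_hochschild.
  + by move=> m x y; apply: bracket_cartan.
split.
- move=> a x; rewrite /= (bracketE _ _ _ (inc_homog Om a : _ \in deg 0%:Z)).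
  (* At degree 0 the part from [delta] is [perp (d (inc a)) x], which the second [perp] term
     cancels. *)
  rewrite delta_inc mul0r subr0 expr0 !scale1r delta_perp.
  by rewrite !(perp_inc _ _).2 addr0 subrr /d linear0 subr0.
- by exists delta.
have [il [ir [_ ir_tensor _ delta_ir]]] := delta_regular.
exists (fun n x y => 2^-1 *: (ir n x y + perp x y)) => n.
have [[irP irDl irDr ir_bal] _ _] := ir_tensor n; split; first split.
- move=> x y hx hy; apply/degZ/degD; first exact: irP.
  by apply: (deg_cast (perp_deg n 1%N _ _ hx hy)); lia.
- move=> c x x' y hx hx' hy; rewrite irDl // linearPl /=.
  by rewrite addrACA -(scalerDr c) (scalerDr 2^-1) !scalerA mulrC.
- move=> c x y y' hx hy hy'; rewrite irDr // linearPr /=.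
  by rewrite addrACA -(scalerDr c) (scalerDr 2^-1) !scalerA mulrC.
- move=> a x y hx hy; rewrite ir_bal //; congr (_ *: (_ + _)).
  (* With a middle argument from [A], the outer terms of the identity vanish and balancedness of
     [perp] remains. *)
  have := perp_cocycle n 0%N x (inc a) y hx (inc_homog Om a).
  by rewrite !(perp_inc _ _).1 !(perp_inc _ _).2 mul0r mulr0 scaler0 !addr0 scale1r.
move=> w a b hw; have hwa : w * inc a \in deg n%:Z.
  by apply: (deg_cast (degM hw (inc_homog Om a))); lia.
have hdb : d (inc b) \in @deg k A Om 1 by apply: d_deg (inc_homog Om b).
(* Right regularity expands [delta (w * inc a * inc b)]; its first term cancels
   [delta (w * inc a) * inc b], leaving [ir] and [perp] at [d (inc b)]. *)
rewrite /= (bracketE _ _ _ hwa) (delta_ir n) // delta_inc mulr0 scaler0 subr0.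
rewrite !(perp_inc _ _).1 /d !(linear0, scaler0, subr0) -!/(d _) -ir_bal //.
have := perp_cocycle n 0%N w (inc a) (d (inc b)) hw (inc_homog Om a).
rewrite (perp_inc _ _).1 (perp_inc _ _).2 mul0r mulr0 scaler0 !addr0 scale1r => <-.
by rewrite [delta _ * _ + _]addrC addrK.
Qed.
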